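(* Let $n\ge 1$ be an integer, and in $\mathbb{Z}_{4n+1}$ let $S=\{\pm(2k-1)\mid k=1,\ldots,n\}$ and $R=\{2n,2n+1\}$. Then the complete graph $K_{4n+1}$ can be expressed as the graphical matrix product of the Cayley graphs $G=\mathrm{Cay}(\mathbb{Z}_{4n+1};S)$ and $H=\mathrm{Cay}(\mathbb{Z}_{4n+1};R)$; that is, there are labelings $g$ of $G$ and $h$ of $H$ such that, with respect to these labelings, $A(G)A(H)=A(K_{4n+1})$.
   Context: For a subset $S=-S$ of $\mathbb{Z}_N$ not containing $0$, $\mathrm{Cay}(\mathbb{Z}_N;S)$ is the simple graph with vertex set $\mathbb{Z}_N$ in which $x$ and $y$ are adjacent if and only if $x-y\in S$. A labeling of a graph on $N$ vertices is a bijection from its vertex set to an $N$-element index set such as $\{0,1,\ldots,N-1\}$ (the same index set for both graphs); it determines the $N\times N$ adjacency matrix $A(\cdot)$ of the graph. $A(K_N)=J_N-I_N$, where $J_N$ is the all-ones matrix. *)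

(* Defs.v *)
From HB Require Import structures.
From mathcomp Require Import all_boot all_order all_algebra.
Set Implicit Arguments.
Unset Strict Implicit.
Unset Printing Implicit Defensive.
Import GRing.Theory.
Local Open Scope ring_scope.

Record sgraph (V : finType) := SGraph {
  adj :> rel V;
  adj_sym : symmetric adj;
  adj_irr : irreflexive adj }.

Section Complete.
Variable V : finType.

Lemma neq_sym : symmetric (fun x y : V => x != y).
Proof. by move=> x y; rewrite eq_sym. Qed.

Lemma neq_irr : irreflexive (fun x y : V => x != y).
Proof. by move=> x; rewrite eqxx. Qed.

Definition complete : sgraph V := SGraph neq_sym neq_irr.
End Complete.

Section Cayley.
Variables (Z : finZmodType) (S : {set Z}).
Hypotheses (S_opp : [set - x | x in S] = S) (S_0 : 0 \notin S).

Lemma cay_sym : symmetric (fun x y : Z => x - y \in S).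
Proof.
have opp u : u \in S -> - u \in S.
  by move=> uS; rewrite -S_opp; apply: imset_f.
by move=> x y; apply/idP/idP => /opp; rewrite opprB.
Qed.

Lemma cay_irr : irreflexive (fun x y : Z => x - y \in S).
Proof. by move=> x; rewrite subrr; apply: negbTE. Qed.

Definition Cay : sgraph Z := SGraph cay_sym cay_irr.
End Cayley.

(* The vertex labeled [i] is adjacent to the vertex labeled [j]; [adjmx] is
   meant for bijective [g], for which [adjmxE] gives its entries. *)
Definition adjmx (V : finType) (N : nat) (G : sgraph V) (g : V -> 'I_N) :
    'M[int]_N :=
  \matrix_(i, j) [exists x, exists y, [&& g x == i, g y == j & G x y]]%:R.

Lemma adjmxE (V : finType) (N : nat) (G : sgraph V) (g : V -> 'I_N) x y :
  bijective g -> adjmx G g (g x) (g y) = (G x y)%:R.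
Proof.
move=> /bij_inj g_inj; rewrite mxE; congr (nat_of_bool _)%:R.
apply/existsP/idP => [[u /existsP[v /and3P[/eqP/g_inj-> /eqP/g_inj->]]] //|Gxy].
by exists x; apply/existsP; exists y; rewrite !eqxx.
Qed.

Lemma adjmx_complete (V : finType) (N : nat) (g : V -> 'I_N) :
  bijective g -> adjmx (complete V) g = const_mx 1 - 1%:M.
Proof.
move=> g_bij; have [f _ gK] := g_bij; apply/matrixP => i j.
rewrite -(gK i) -(gK j) adjmxE //= !mxE (inj_eq (bij_inj g_bij)).
by case: eqP => _; rewrite ?subrr ?subr0.
Qed.

Definition connS (n : nat) : {set 'Z_(4 * n + 1)} :=
  \bigcup_(1 <= k < n.+1) [set (2 * k - 1)%:R; - (2 * k - 1)%:R].

Definition connR (n : nat) : {set 'Z_(4 * n + 1)} :=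
  [set (2 * n)%:R; (2 * n + 1)%:R].

Lemma connS_opp n : [set - x | x in connS n] = connS n.
Proof.
have opp x : x \in connS n -> - x \in connS n.
  rewrite /connS; elim/big_ind: _ => [|A B hA hB|k _]; first by rewrite !inE.
    by rewrite !inE => /orP[/hA->|/hB->]; rewrite ?orbT.
  by rewrite !inE eqr_opp eqr_oppLR orbC.
apply/setP => x; apply/imsetP/idP => [[y /opp yS ->] //|/opp xS].
by exists (- x); rewrite ?opprK.
Qed.

Lemma natrZ_neq0 n m : (0 < m < 4 * n + 1)%N -> (m%:R : 'Z_(4 * n + 1)) != 0.
Proof.
move=> /andP[m0 mN]; apply/eqP => /(congr1 val) /=.
by rewrite val_Zp_nat ?(leq_ltn_trans m0 mN) // modn_small // => m_0; rewrite m_0 in m0.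
Qed.

Lemma connS_0 n : 0 \notin connS n.
Proof.
rewrite /connS big_seq; elim/big_ind: _ => [|A B hA hB|k].
- by rewrite inE.
- by rewrite inE negb_or hA hB.
rewrite mem_index_iota ltnS => /andP[k0 kn].
have h : (0 < 2 * k - 1 < 4 * n + 1)%N.
  rewrite subn_gt0 (leq_trans _ (leq_mul (leqnn 2) k0)) //=.
  apply: (@leq_ltn_trans (4 * n)); last by rewrite addn1.
  by apply: leq_trans (leq_subr _ _) _; apply: leq_mul.
by rewrite !inE ![0 == _]eq_sym oppr_eq0 orbb natrZ_neq0.
Qed.

Lemma connR_opp n : (0 < n)%N -> [set - x | x in connR n] = connR n.
Proof.
move=> n0; rewrite /connR imsetU1 imset_set1.
have e : (2 * n)%:R + (2 * n + 1)%:R = 0 :> 'Z_(4 * n + 1).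
  rewrite -natrD addnA -mulnDl pchar_Zp //.
  by rewrite addn1 ltnS muln_gt0.
have -> : (2 * n + 1)%:R = - (2 * n)%:R :> 'Z_(4 * n + 1).
  by apply/eqP; rewrite -addr_eq0 addrC e.
by rewrite opprK setUC.
Qed.

Lemma connR_0 n : (0 < n)%N -> 0 \notin connR n.
Proof.
move=> n0; rewrite !inE ![0 == _]eq_sym negb_or; apply/andP; split.
  apply: natrZ_neq0; rewrite muln_gt0 n0 addn1 ltnS /=; exact: leq_mul.
by apply: natrZ_neq0; rewrite addn1 /= addn1 ltnS ltn_pmul2r.
Qed.

(* Main.v *)
Require Import Defs.
From mathcomp Require Import all_boot all_order all_algebra.
From mathcomp Require Import zify.
Import GRing.Theory.
Local Open Scope ring_scope.

(** The identity labeling already works, because the sums [s + r] with [s] in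
    [S] and [r] in [R] run over every nonzero residue exactly once.  Put
    [N = 4n+1].  The set [S] consists of the [2n] odd integers
    [-(2n-1), ..., -1, 1, ..., 2n-1], a progression with common difference 2,
    and [R] consists of [2n+1] and its opposite [2n].  Translating [S] by [2n+1]
    gives exactly [2, 4, ..., 4n], the nonzero residues with even representative
    ([connS_shift]).  Since [S = -S], translating it by [-(2n+1)] gives the
    opposites of these; as [N] is odd, they are the residues with odd
    representative ([connS_shiftN]).  The two translates therefore partition the
    nonzero residues.

    The entry of [A(G)A(H)] at [x, y] counts the vertices [z] with [x - z] in
    [S] and [z - y] in [R], that is, the ways to write [x - y] as such a sum
    ([card_connSR]); it is thus 1 when [x != y] and 0 otherwise. *)

Lemma connSP n (x : 'Z_(4 * n + 1)) :
  reflect (exists2 k : nat, (0 < k <= n)%N &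
             x = (2 * k - 1)%:R \/ x = - (2 * k - 1)%:R)
          (x \in connS n).
Proof.
rewrite /connS big_add1 big_mkord; apply: (iffP bigcupP) => [[i _]|[k kn x_k]].
  by rewrite !inE => /orP[]/eqP x_i; exists i.+1; rewrite ?ltn_ord //; [left|right].
case: k kn x_k => // k /= kn x_k; exists (Ordinal kn) => //.
by rewrite !inE; case: x_k => ->; rewrite eqxx ?orbT.
Qed.

Section Residues.
Variables (n : nat) (n_gt0 : (0 < n)%N).
Local Notation N := (4 * n + 1)%N.
Implicit Types (x y u : 'Z_N).

Lemma N_gt1 : (1 < N)%N. Proof. lia. Qed.

Lemma natrN_eq0 : N%:R = 0 :> 'Z_N.
Proof. exact: pchar_Zp N_gt1. Qed.

Lemma val_natr m : (m < N)%N -> (m%:R : 'Z_N) = m :> nat.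
Proof. by move=> mN; rewrite val_Zp_nat ?N_gt1 // modn_small. Qed.

Lemma ltn_val u : (u < N)%N.
Proof. by rewrite -{2}(Zp_cast N_gt1). Qed.

Lemma val_gt0 u : u != 0 -> (0 < u)%N.
Proof. by rewrite lt0n; apply: contraNneq => u0; rewrite -(natr_Zp u) u0. Qed.

(** Adding [2n] amounts to undoing the translation by [2n+1]:
    [(2k-1) + (2n+1) = 2(n+k)] and [-(2k-1) + (2n+1) = 2(n+1-k)], so that
    [k = 1, ..., n] yields each of [2, 4, ..., 4n] once. *)
Lemma connS_shift u :
  (u + (2 * n)%:R \in connS n) = (u != 0) && ~~ odd u.
Proof.
have u_lt := ltn_val u.
apply/connSP/andP => [[k k_n u_k] | [u_neq0 u_even]].
  have [m m_n u_m] : exists2 m : nat, (0 < 2 * m < N)%N & u = (2 * m)%:R.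
    case: u_k => /(canRL (addrK _)) ->; [exists (n + k)%N | exists (n + 1 - k)%N];
      try lia; apply/eqP; rewrite -subr_eq0 -?opprD -?natrD.
      rewrite -addrA -opprD -natrD.
      have -> : (2 * n + 2 * (n + k) = N + (2 * k - 1))%N by lia.
      by rewrite natrD natrN_eq0 add0r subrr.
    have -> : (2 * k - 1 + 2 * n + 2 * (n + 1 - k) = N)%N by lia.
    by rewrite natrN_eq0 oppr0.
  by rewrite u_m natrZ_neq0 // val_natr ?oddM //; case/andP: m_n.
have u_gt0 := val_gt0 _ u_neq0.
have u_half : nat_of_ord u = (2 * u./2)%N by lia.
rewrite -[u in u + _]natr_Zp; case: (leqP u (2 * n)) => u_n.
  exists (n + 1 - u./2)%N; [lia | right].
  apply/eqP; rewrite -addr_eq0 -!natrD.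
  have -> : (u + 2 * n + (2 * (n + 1 - u./2) - 1) = N)%N by lia.
  by rewrite natrN_eq0.
exists (u./2 - n)%N; [lia | left].
rewrite -natrD.
have -> : (u + 2 * n = N + (2 * (u./2 - n) - 1))%N by lia.
by rewrite natrD natrN_eq0 add0r.
Qed.

Lemma odd_oppZ u : u != 0 -> odd (- u : 'Z_N) = ~~ odd u.
Proof.
move=> u_neq0; have u_lt := ltn_val u.
have u_gt0 := val_gt0 _ u_neq0.
have -> : - u = (N - u)%:R.
  apply/esym/eqP; rewrite -addr_eq0 -{2}(natr_Zp u) -natrD.
  by rewrite subnK ?natrN_eq0 // ltnW.
rewrite val_natr; lia.
Qed.

(** The reflection [u -> -u] preserves [S] and, the modulus being odd, exchanges
    the two parities of nonzero representatives. *)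
Lemma connS_shiftN u :
  (u - (2 * n)%:R \in connS n) = (u != 0) && odd u.
Proof.
have oppS x : (- x \in connS n) = (x \in connS n).
  by rewrite -{1}connS_opp (mem_imset _ _ oppr_inj).
rewrite -oppS opprB addrC connS_shift oppr_eq0.
by case: eqVneq => //= u_neq0; rewrite odd_oppZ // negbK.
Qed.

Lemma connRE : connR n = [set (2 * n)%:R; - (2 * n)%:R].
Proof.
congr [set _; _]; apply/eqP; rewrite -addr_eq0 -natrD.
have -> : (2 * n + 1 + 2 * n = N)%N by lia.
by rewrite natrN_eq0.
Qed.

Lemma connR_distinct : (2 * n)%:R != - (2 * n)%:R :> 'Z_N.
Proof.
by rewrite -addr_eq0 -natrD natrZ_neq0 //; lia.
Qed.

(** Only [z = y + 2n] and [z = y - 2n] can contribute, and they do so according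
    to the parity of the representative of [x - y]. *)
Lemma card_connSR x y :
  \sum_z (x - z \in connS n)%:R * (z - y \in connR n)%:R = (x != y)%:R :> int.
Proof.
rewrite (reindex_inj (addrI y)) /=.
under eq_bigr => z _ do rewrite addrAC subrr add0r opprD addrA.
transitivity (\sum_(z in connR n) (x - y - z \in connS n)%:R : int).
  rewrite [RHS]big_mkcond; apply: eq_bigr => z _.
  by case: (z \in connR n); rewrite ?mulr1 ?mulr0.
rewrite connRE big_setU1 ?inE ?connR_distinct //= big_set1 opprK.
rewrite connS_shift connS_shiftN subr_eq0.
by case: (x == y) => //=; case: odd.
Qed.

End Residues.

Theorem theorem3p18 (n : nat) (hn : (1 <= n)%N) :
  let N := (4 * n + 1)%N in
  let G : sgraph 'Z_N := Cay (connS_opp n) (connS_0 n) in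
  let H : sgraph 'Z_N := Cay (connR_opp hn) (connR_0 hn) in
  exists (g h : 'Z_N -> 'I_N),
    [/\ bijective g, bijective h &
        adjmx G g *m adjmx H h = adjmx (complete 'I_N) id].
Proof.
move=> N G H; pose g : 'Z_N -> 'I_N := cast_ord (Zp_cast (N_gt1 n hn)).
have g_bij : bijective g.
  exists (cast_ord (esym (Zp_cast (N_gt1 n hn)))).
    exact: cast_ordK.
  exact: cast_ordKV.
exists g, g; split=> //; have [f _ gK] := g_bij.
apply/matrixP => i j; rewrite mxE -(gK i) -(gK j).
rewrite (adjmxE (complete _) _ _ (Bijective (fun=> erefl) (fun=> erefl))) /=.
rewrite (inj_eq (bij_inj g_bij)) -card_connSR //.
rewrite (reindex g) /=; last exact: onW_bij.
by apply: eq_bigr => z _; rewrite !adjmxE.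
Qed.
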